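(* Let $$\widetilde{P}(x,u,q)=\sum_{k\geq 0}\sum_{n\geq k}\sum_{\pi\in P_{n,k}}\frac{x^nu^kq^{\mathrm{sumelements}(\pi)}}{n!}.$$ Then $$\frac{\partial}{\partial q}\widetilde{P}(x,u,q)\Big|_{u=q=1}=e^{e^x-1}\left(\frac{1}{3}e^{3x}-\frac{1}{2}xe^{2x}+\frac{3}{4}e^{2x}-xe^x-e^{x}-\frac{1}{12}\right).$$
   Context: A set partition of $[n]$ with exactly $k$ blocks is a collection $\{B_1,\dots,B_k\}$ of nonempty pairwise disjoint subsets with union $[n]$, indexed so that $\min B_1<\cdots<\min B_k$; $P_{n,k}$ is the set of such partitions ($P_{0,0}$ consists of the empty partition). A partition is identified with its canonical sequential form $\pi=\pi_1\cdots\pi_n$, where $i\in B_{\pi_i}$. An entry $\pi_i$ is a record if $\pi_i>\pi_j$ for all $j<i$; the records are the first occurrences of $1,\dots,k$. For $a\in[k]$, $\mathrm{sumelements}_a(\pi)$ is the sum of all entries of $\pi$ at positions strictly before the record $a$, and $\mathrm{sumelements}(\pi)=\sum_{a=1}^{k}\mathrm{sumelements}_a(\pi)$. The generating function is a formal power series in $x$ (exponential) and $u$, with polynomial coefficients in $q$. *)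

(* Defs.v *)
From HB Require Import structures.
From mathcomp Require Import all_boot all_order all_algebra.
From mathcomp Require Import boolp.

Set Implicit Arguments.
Unset Strict Implicit.
Unset Printing Implicit Defensive.

Import Order.TTheory GRing.Theory Num.Theory.
Local Open Scope ring_scope.

(** [fps R] is R[[t]]; a series in x and u over Q[q] is an element of
    [fps (fps {poly rat})], i.e. (Q[q][[u]])[[x]], where x is the outer
    variable. *)

Record fps (R : Type) := FPS { fps_coef :> nat -> R }.

HB.instance Definition _ (R : Type) := gen_eqMixin (fps R).
HB.instance Definition _ (R : Type) := gen_choiceMixin (fps R).

Lemma fpsP (R : Type) (f g : fps R) : f =1 g -> f = g.
Proof. by case: f g => [f] [g] /= /funext ->. Qed.

Section FpsZmod.
Variable R : zmodType.
Implicit Types f g : fps R.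

Definition fps_zero : fps R := FPS (fun=> 0).
Definition fps_opp f : fps R := FPS (fun n => - f n).
Definition fps_add f g : fps R := FPS (fun n => f n + g n).

Lemma fps_addA : associative fps_add.
Proof. by move=> f g h; apply: fpsP => n /=; rewrite addrA. Qed.
Lemma fps_addC : commutative fps_add.
Proof. by move=> f g; apply: fpsP => n /=; rewrite addrC. Qed.
Lemma fps_add0 : left_id fps_zero fps_add.
Proof. by move=> f; apply: fpsP => n /=; rewrite add0r. Qed.
Lemma fps_addN : left_inverse fps_zero fps_opp fps_add.
Proof. by move=> f; apply: fpsP => n /=; rewrite addNr. Qed.

HB.instance Definition _ := GRing.isZmodule.Build (fps R)
  fps_addA fps_addC fps_add0 fps_addN.

End FpsZmod.

Section FpsRing.
Variable R : comNzRingType.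
Implicit Types (f g h : fps R) (a b : R).

Definition fps_one : fps R := FPS (fun n => (n == 0%N)%:R).
Definition fps_mul f g : fps R :=
  FPS (fun n => \sum_(i < n.+1) f i * g (n - i)%N).
Definition fps_scale a f : fps R := FPS (fun n => a * f n).

Definition fps_trunc m f : {poly R} := \poly_(i < m) f i.

Lemma coef_fps_trunc m f n : (n < m)%N -> (fps_trunc m f)`_n = f n.
Proof. by move=> ltnm; rewrite coef_poly ltnm. Qed.

Lemma fps_mulE m f g n : (n < m)%N ->
  fps_mul f g n = (fps_trunc m f * fps_trunc m g)`_n.
Proof.
move=> ltnm; rewrite coefM; apply: eq_bigr => i _.
have lein : (i <= n)%N by rewrite -ltnS.
by rewrite !coef_fps_trunc //; apply: leq_ltn_trans ltnm; rewrite ?leq_subr.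
Qed.

Lemma fps_mulA : associative fps_mul.
Proof.
move=> f g h; apply: fpsP => n.
rewrite !(@fps_mulE n.+1) //.
have tr f1 g1 i : (i <= n)%N -> (fps_trunc n.+1 (fps_mul f1 g1))`_i =
    (fps_trunc n.+1 f1 * fps_trunc n.+1 g1)`_i.
  by move=> lein; rewrite coef_fps_trunc ?ltnS // (@fps_mulE n.+1).
transitivity ((fps_trunc n.+1 f * (fps_trunc n.+1 g * fps_trunc n.+1 h))`_n).
  by rewrite [LHS]coefM [RHS]coefM; apply: eq_bigr => i _; rewrite tr ?leq_subr.
rewrite mulrA [LHS]coefM [RHS]coefM.
by apply: eq_bigr => i _; rewrite tr // -ltnS.
Qed.

Lemma fps_mulC : commutative fps_mul.
Proof. by move=> f g; apply: fpsP => n; rewrite !(@fps_mulE n.+1) // mulrC. Qed.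

Lemma fps_mul1 : left_id fps_one fps_mul.
Proof.
move=> f; apply: fpsP => n /=.
by rewrite big_ord_recl big1 /= ?mul1r ?addr0 ?subn0 // => i _; rewrite mul0r.
Qed.

Lemma fps_mulDl : left_distributive fps_mul (@GRing.add (fps R)).
Proof.
move=> f g h; apply: fpsP => n /=; rewrite -big_split /=.
by apply: eq_bigr => i _; rewrite mulrDl.
Qed.

Lemma fps_one_neq0 : fps_one != 0.
Proof.
apply/eqP => /(congr1 (fun f : fps R => f 0%N)) /= /eqP.
by rewrite oner_eq0.
Qed.

HB.instance Definition _ := GRing.Zmodule_isComNzRing.Build (fps R)
  fps_mulA fps_mulC fps_mul1 fps_mulDl fps_one_neq0.

Lemma fps_scaleA a b f : fps_scale a (fps_scale b f) = fps_scale (a * b) f.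
Proof. by apply: fpsP => n /=; rewrite mulrA. Qed.
Lemma fps_scale1 : left_id 1 fps_scale.
Proof. by move=> f; apply: fpsP => n /=; rewrite mul1r. Qed.
Lemma fps_scaleDr : right_distributive fps_scale +%R.
Proof. by move=> a f g; apply: fpsP => n /=; rewrite mulrDr. Qed.
Lemma fps_scaleDl f : {morph fps_scale^~ f : a b / a + b}.
Proof. by move=> a b; apply: fpsP => n /=; rewrite mulrDl. Qed.

HB.instance Definition _ := GRing.Zmodule_isLmodule.Build R (fps R)
  fps_scaleA fps_scale1 fps_scaleDr fps_scaleDl.

Lemma fps_scaleAl a f g : a *: (f * g) = (a *: f) * g.
Proof.
apply: fpsP => n /=; rewrite mulr_sumr.
by apply: eq_bigr => i _; rewrite mulrA.
Qed.

HB.instance Definition _ := GRing.Lmodule_isLalgebra.Build R (fps R)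
  fps_scaleAl.
HB.instance Definition _ := GRing.Lalgebra_isComAlgebra.Build R (fps R).

Definition fpsX : fps R := FPS (fun n => (n == 1%N)%:R).

(** The composite f(g(t)) when [g 0 = 0]: then [g ^+ k] has no term of degree
    less than k, so that only the k <= n contribute in degree n. *)
Definition fps_comp f g : fps R :=
  FPS (fun n => \sum_(k < n.+1) f k * (g ^+ k) n).

(** [f] can be evaluated at [a], with value [s]: the partial sums of
    f_0 + f_1 a + f_2 a^2 + ... are eventually equal to [s]. *)
Definition fps_eval f a s : Prop :=
  exists N, forall K, (N <= K)%N -> \sum_(k < K) f k * a ^+ k = s.

End FpsRing.

Arguments fpsX {R}.

Definition fps_map (R S : Type) (phi : R -> S) (f : fps R) : fps S :=
  FPS (fun n => phi (f n)).

(** [fps_exp g] is e^g, for [g] with zero constant term. *)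
Definition fps_exp (F : fieldType) (g : fps F) : fps F :=
  fps_comp (FPS (fun n => n`!%:R^-1)) g.

Definition deriv_q (F : fps (fps {poly rat})) : fps (fps {poly rat}) :=
  fps_map (fps_map (@deriv rat)) F.

Definition eval_q (c : rat) (F : fps (fps {poly rat})) : fps (fps rat) :=
  fps_map (fps_map (fun p : {poly rat} => p.[c])) F.

Definition eval_u (F : fps (fps rat)) (c : rat) (G : fps rat) : Prop :=
  forall n, fps_eval (F n) c (G n).

(** The set [n] is represented by ['I_n], so that positions are shifted by
    one; the blocks and the entries of the canonical sequential form are
    numbered from 1. *)

Section SetPartitions.
Local Open Scope nat_scope.

Definition set_partitions (n k : nat) : {set {set {set 'I_n}}} :=
  [set P | partition P [set: 'I_n] & #|P| == k].

(** The default value [n] is only reached when [B] is empty. *)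
Definition min_block n (B : {set 'I_n}) : nat :=
  \big[minn/n]_(i in B) (i : nat).

(** B_1, ..., B_k, where min B_1 < ... < min B_k. *)
Definition blocks n (P : {set {set 'I_n}}) : seq {set 'I_n} :=
  sort (fun B C => min_block B <= min_block C) (enum P).

Definition canonical_form n (P : {set {set 'I_n}}) : seq nat :=
  [seq (find (fun B : {set 'I_n} => i \in B) (blocks P)).+1 | i <- enum 'I_n].

Definition is_record (w : seq nat) (i : nat) : bool :=
  all (fun y => y < nth 0 w i) (take i w).

(** The position of the record [a]; it is unique, as the values of the records
    of a word increase strictly. *)
Definition record_pos (w : seq nat) (a : nat) : nat :=
  find (fun i => is_record w i && (nth 0 w i == a)) (iota 0 (size w)).

Definition sumelements_at (w : seq nat) (a : nat) : nat :=
  sumn (take (record_pos w a) w).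

Definition sumelements n (P : {set {set 'I_n}}) : nat :=
  \sum_(1 <= a < #|P|.+1) sumelements_at (canonical_form P) a.

End SetPartitions.

(** [Ptilde n k] is the coefficient of x^n u^k; the sum is empty unless
    k <= n. *)
Definition Ptilde : fps (fps {poly rat}) :=
  FPS (fun n => FPS (fun k =>
    \sum_(P in set_partitions n k) n`!%:R^-1 *: 'X^(sumelements P))).

(* Main.v *)
(* A restricted growth word with maximum k is extended either by a letter
   1, ..., k, which creates no record, or by k + 1, which creates a record
   preceded by the whole word. Hence, among words with maximum k, the number
   N_k, the total S_k of the sums of the letters and the total T_k of
   sumelements have exponential generating functions satisfying
     N_k' = k N_k + N_(k-1),
     S_k' = k S_k + k(k+1)/2 N_k + S_(k-1) + k N_(k-1),
     T_k' = k T_k + T_(k-1) + S_(k-1).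
   So N_k = (e^x - 1)^k / k!, and S_k and T_k are found as combinations of
   N_(k-1), N_(k-2) and of N_(k-2), N_(k-3) with coefficients independent
   of k; summing T_k over k replaces each N by e^(e^x - 1). *)
Require Import Defs.
From HB Require Import structures.
From mathcomp Require Import all_boot all_order all_algebra.
From mathcomp Require Import boolp.
From mathcomp Require Import zify ring.
Import Order.TTheory GRing.Theory Num.Theory.
Local Open Scope ring_scope.

Set Implicit Arguments.
Unset Strict Implicit.
Unset Printing Implicit Defensive.

(** * Coefficients of sums, products and powers of series *)

Lemma fps_mul_coef (R : comNzRingType) (f g : fps R) n :
  (f * g) n = \sum_(i < n.+1) f i * g (n - i)%N.
Proof. by []. Qed.

Lemma fps_mul_coef0 (R : comNzRingType) (f g : fps R) :
  (f * g) 0%N = f 0%N * g 0%N.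
Proof. by rewrite fps_mul_coef big_ord1. Qed.

Lemma fps_coefD (R : comNzRingType) (f g : fps R) n : (f + g) n = f n + g n.
Proof. by []. Qed.

Lemma fps_coefN (R : comNzRingType) (f : fps R) n : (- f) n = - f n.
Proof. by []. Qed.

Lemma fps_coef_nat (R : comNzRingType) m : (m%:R : fps R) 0%N = m%:R.
Proof. by elim: m => [//|m IHm]; rewrite !mulrS fps_coefD IHm. Qed.

Lemma fps_sum_coef (R : comNzRingType) (I : Type) (r : seq I) (P : pred I)
    (F : I -> fps R) n :
  (\sum_(i <- r | P i) F i) n = \sum_(i <- r | P i) F i n.
Proof. exact: (big_morph (fun f : fps R => f n)). Qed.

Lemma fps_exprX_coef (R : comNzRingType) k n :
  ((fpsX : fps R) ^+ k) n = (n == k)%:R.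
Proof.
elim: k n => [//|k IHk] [|n]; rewrite exprS fps_mul_coef big_ord_recl /= mul0r add0r.
  by rewrite big_ord0.
rewrite big_ord_recl /= mul1r big1 ?addr0 => [|i _]; last by rewrite mul0r.
by rewrite subSS subn0 IHk eqSS.
Qed.

Lemma fps_expr_order (R : comNzRingType) (g : fps R) k n :
  g 0%N = 0 -> (n < k)%N -> (g ^+ k) n = 0.
Proof.
move=> g0; elim: k n => [//|k IHk] n ltnk.
rewrite exprS fps_mul_coef big_ord_recl /= g0 mul0r add0r big1 // => i _.
by rewrite IHk ?mulr0 // /bump /=; case: i => /= i; lia.
Qed.

(** * Formal differentiation *)

Section Derivation.
Variable R : comNzRingType.
Implicit Types (f g : fps R).

Definition fps_deriv f : fps R := FPS (fun n => n.+1%:R * f n.+1).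

Lemma fps_derivD f g : fps_deriv (f + g) = fps_deriv f + fps_deriv g.
Proof. by apply: fpsP => n /=; rewrite mulrDr. Qed.

Lemma fps_derivZ a f : fps_deriv (a *: f) = a *: fps_deriv f.
Proof. by apply: fpsP => n /=; rewrite mulrCA. Qed.

Lemma fps_deriv_alg a : fps_deriv a%:A = 0.
Proof. by apply: fpsP => n /=; rewrite !mulr0. Qed.

Lemma fps_derivN f : fps_deriv (- f) = - fps_deriv f.
Proof. by rewrite -scaleN1r fps_derivZ scaleN1r. Qed.

Lemma fps_deriv_nat m : fps_deriv m%:R = 0.
Proof. by rewrite -scaler_nat fps_deriv_alg. Qed.

Lemma fps_deriv1 : fps_deriv 1 = 0.
Proof. exact: (fps_deriv_nat 1). Qed.

Lemma fps_derivX : fps_deriv fpsX = 1.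
Proof. by apply: fpsP => -[|n] /=; rewrite ?mulr1 ?mulr0. Qed.

Lemma fps_derivM f g : fps_deriv (f * g) = fps_deriv f * g + f * fps_deriv g.
Proof.
apply: fpsP => n.
have -> : fps_deriv (f * g) n = n.+1%:R * fps_mul f g n.+1 by [].
(* Degree n + 1 of the product only sees both factors truncated below degree n + 2, so the product
   rule for polynomials applies. *)
rewrite (fps_mulE (m := n.+2)) // mulr_natl -coef_deriv derivM coefD.
rewrite !coefM; congr (_ + _); apply: eq_bigr => i _.
  rewrite coef_deriv [RHS]/= mulr_natl.
  by rewrite !coef_fps_trunc //; case: i => /= i; rewrite ltnS; lia.
rewrite coef_deriv [RHS]/= mulr_natl.
by rewrite !coef_fps_trunc //; case: i => /= i; rewrite ltnS; lia.
Qed.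

Lemma fps_derivXn f k : fps_deriv (f ^+ k.+1) = k.+1%:R *: (f ^+ k * fps_deriv f).
Proof.
elim: k => [|k IHk]; first by rewrite expr0 mul1r scale1r expr1.
rewrite exprS fps_derivM IHk -scalerAr mulrA -exprS mulrC -[X in X + _]scale1r.
rewrite -scalerDl. by rewrite -[in RHS]natr1 addrC.
Qed.

Definition fps_derivE := (fps_derivM, fps_derivD, fps_derivN, fps_deriv_nat,
  fps_deriv1, fps_derivX, fps_deriv_alg).

End Derivation.

(* The coefficients of a solution of a linear equation f' = a f + g are
   determined one after the other. *)
Lemma fps_ode_uniq (a : rat) (f g : fps rat) :
  f 0%N = g 0%N -> fps_deriv f - a *: f = fps_deriv g - a *: g -> f = g.
Proof.
move=> eq0 eqD; apply: fpsP; elim=> [//|n IHn].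
have /= := congr1 (fun h : fps rat => h n) eqD.
rewrite IHn => /addIr /(mulfI _) -> //.
by rewrite pnatr_eq0.
Qed.

(** * Exponential series and their differential equations *)

Lemma fps_exp_scaleX (c : rat) n : fps_exp (c *: fpsX) n = c ^+ n / n`!%:R.
Proof.
rewrite /= big_ord_recr /= big1 ?add0r => [|i _]; last first.
  by rewrite exprZn /= fps_exprX_coef gtn_eqF ?mulr0.
by rewrite exprZn /= fps_exprX_coef eqxx mulr1 mulrC.
Qed.

Lemma fps_deriv_exp (c : rat) :
  fps_deriv (fps_exp (c *: fpsX)) = c *: fps_exp (c *: fpsX).
Proof.
apply: fpsP => n; rewrite [LHS]/= -/(fps_coef _ _).
rewrite -[X in _ * X]/(fps_exp (c *: fpsX) n.+1) -[RHS]/(c * fps_exp (c *: fpsX) n).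
rewrite !fps_exp_scaleX factS natrM exprS invfM.
by field; rewrite pnatr_eq0 -lt0n fact_gt0 nat1r pnatr_eq0.
Qed.

Lemma fps_exp0 (g : fps rat) : fps_exp g 0%N = 1.
Proof. by rewrite /= big_ord1 expr0 /= divr1. Qed.

(** The rule e^(ax) e^(bx) = e^((a+b)x) in abstract form: both sides solve y' = c y with the same
    constant term. *)
Lemma fps_eigen_mul (a b c : rat) (f g h : fps rat) :
    fps_deriv f = a *: f -> fps_deriv g = b *: g -> fps_deriv h = c *: h ->
    a + b = c -> f 0%N * g 0%N = h 0%N ->
  f * g = h.
Proof.
move=> Df Dg Dh abc eq0; apply: (@fps_ode_uniq c); first by rewrite fps_mul_coef0.
by rewrite fps_derivM Df Dg Dh -scalerAl -scalerAr -scalerDl abc !subrr.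
Qed.

(** * Restricted growth words and their records *)

Section Words.
Local Open Scope nat_scope.
Implicit Types (w : seq nat).

Definition max_letter w : nat := \max_(c <- w) c.

Fixpoint rg_words n : seq (seq nat) :=
  if n is n'.+1
  then [seq rcons w c | w <- rg_words n', c <- iota 1 (max_letter w).+1]
  else [:: [::]].

Definition restricted_growth w :=
  forall i, i < size w -> 0 < nth 0 w i <= (max_letter (take i w)).+1.

Lemma max_letter_rcons w c : max_letter (rcons w c) = maxn (max_letter w) c.
Proof. by rewrite /max_letter -cats1 big_cat big_seq1. Qed.

Lemma leq_max_letter w c : c \in w -> c <= max_letter w.
Proof. by move=> cw; apply: (@leq_bigmax_seq _ _ predT id). Qed.

Lemma restricted_growth_rcons w c :
  restricted_growth (rcons w c) <->
  restricted_growth w /\ 0 < c <= (max_letter w).+1.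
Proof.
split=> [rgw | [rgw hc] i].
  split=> [i ltiw|].
    have := rgw i; rewrite size_rcons nth_rcons ltiw -cats1 takel_cat ?(ltnW ltiw) //.
    by apply; apply: ltnW.
  have := rgw (size w); rewrite size_rcons nth_rcons ltnn eqxx -cats1 takel_cat //.
  by rewrite take_size; apply.
rewrite size_rcons ltnS leq_eqVlt nth_rcons => /predU1P[->|ltiw].
  by rewrite ltnn !eqxx -cats1 takel_cat // take_size.
by rewrite ltiw -cats1 takel_cat ?(ltnW ltiw) //; apply: rgw.
Qed.

Lemma mem_rg_words n w :
  w \in rg_words n <-> size w = n /\ restricted_growth w.
Proof.
elim: n w => [|n IHn] w.
  by rewrite inE; split=> [/eqP -> //| [/size0nil -> //]].
split=> [/allpairsPdep [v [c []]] | []].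
  move=> /IHn [<- rgv]; rewrite mem_iota addnC addn1 => hc ->.
  by rewrite size_rcons restricted_growth_rcons.
case/lastP: w => [//|v c]; rewrite size_rcons => -[szv].
rewrite restricted_growth_rcons => -[rgv hc].
apply/allpairsPdep; exists v, c; split=> //; first exact/IHn.
by rewrite mem_iota addnC addn1.
Qed.

Lemma rg_words_uniq n : uniq (rg_words n).
Proof.
elim: n => [//|n IHn]; apply: allpairs_uniq_dep => // [w _|]; first exact: iota_uniq.
by move=> [w c] [v d] _ _ /= /rcons_inj [-> ->].
Qed.

(** Each letter raises the maximum by at most one, so no value is skipped. *)
Lemma restricted_growth_letter w a :
  restricted_growth w -> 0 < a <= max_letter w -> a \in w.
Proof.
elim/last_ind: w => [|w c IHw]; first by rewrite /max_letter big_nil; lia.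
rewrite restricted_growth_rcons max_letter_rcons mem_rcons inE => -[rgw hc] ha.
have [//|neac] := eqVneq a c; apply: IHw => //; lia.
Qed.

(** Read from the left, a letter is either a repetition, which the kernel locates among the earlier
    letters, or new, and then growth forces it to be the maximum plus one. *)
Lemma restricted_growth_kernel_inj w v :
    restricted_growth w -> restricted_growth v -> size w = size v ->
    (forall i j, i < size w -> j < size w ->
       (nth 0 w i == nth 0 w j) = (nth 0 v i == nth 0 v j)) ->
  w = v.
Proof.
elim/last_ind: w v => [|w c IHw] v; first by case: v.
case/lastP: v => [|v d]; rewrite !size_rcons // => /restricted_growth_rcons[rgw hc].
move=> /restricted_growth_rcons[rgv hd] [eqsz] ker.
have eqwv : w = v.
  apply: IHw => // i j lti ltj; have := ker i j.
  by rewrite !nth_rcons -!eqsz lti ltj => -> //; apply: ltnW.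
subst v; congr (rcons w _).
have kerl i : i < size w -> (nth 0 w i == c) = (nth 0 w i == d).
  move=> lti; have := ker i (size w); rewrite !nth_rcons lti ltnn eqxx.
  by apply=> //; apply: ltnW.
have eq1 a b : (forall i, i < size w -> (nth 0 w i == a) = (nth 0 w i == b)) ->
    0 < a <= max_letter w -> a = b.
  move=> kerab /(restricted_growth_letter rgw) /(nthP 0) [i lti nthi].
  by apply/esym/eqP; rewrite -nthi eq_sym -kerab ?nthi.
(* If [c] or [d] is at most the maximum, it occurs in [w] and [eq1] identifies the two; otherwise
   both are the maximum plus one. *)
have [lec|ltc] := leqP c (max_letter w); first by apply: eq1 => //; lia.
have [led|ltd] := leqP d (max_letter w); last lia.
by apply/esym/eq1 => [i /kerl//|]; lia.
Qed.

Lemma is_record_rcons w c i : i < size w ->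
  is_record (rcons w c) i = is_record w i.
Proof.
by move=> lti; rewrite /is_record nth_rcons lti -cats1 takel_cat // ltnW.
Qed.

(** This ensures that the search in [record_pos] succeeds instead of returning the length of the
    word. *)
Lemma has_record w a : restricted_growth w -> 0 < a <= max_letter w ->
  has (fun i => is_record w i && (nth 0 w i == a)) (iota 0 (size w)).
Proof.
elim/last_ind: w => [|w c IHw]; first by rewrite /max_letter big_nil; lia.
rewrite restricted_growth_rcons max_letter_rcons => -[rgw hc] ha.
rewrite size_rcons -addn1 iotaD has_cat /= orbF add0n.
have [lea|lta] := leqP a (max_letter w).
  apply/orP; left; have /hasP[i iw /andP[reci nthi]] : has _ _ := IHw rgw ltac:(lia).
  apply/hasP; exists i => //; move: iw; rewrite mem_iota add0n => /= lti.
  by rewrite is_record_rcons // reci nth_rcons lti.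
apply/orP; right; have -> : a = c by lia.
rewrite /is_record !nth_rcons ltnn !eqxx -cats1 takel_cat // take_size andbT.
by apply/allP => y /leq_max_letter; lia.
Qed.

Lemma record_pos_lt w a : restricted_growth w -> 0 < a <= max_letter w ->
  record_pos w a < size w.
Proof. by move=> rgw ha; rewrite -[X in _ < X](size_iota 0) -has_find has_record. Qed.

(** The search runs from the left and already succeeds inside [w]. *)
Lemma record_pos_rcons w c a : restricted_growth w -> 0 < a <= max_letter w ->
  record_pos (rcons w c) a = record_pos w a.
Proof.
move=> rgw ha; rewrite /record_pos size_rcons -addn1 iotaD find_cat.
have eqf : {in iota 0 (size w),
    (fun i => is_record (rcons w c) i && (nth 0 (rcons w c) i == a)) =1
    (fun i => is_record w i && (nth 0 w i == a))}.
  by move=> i; rewrite mem_iota add0n => /= lti; rewrite is_record_rcons // nth_rcons lti.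
by rewrite (eq_in_has eqf) has_record // (eq_in_find eqf).
Qed.

Lemma record_pos_new w c : restricted_growth w -> max_letter w < c ->
  record_pos (rcons w c) c = size w.
Proof.
move=> rgw ltc; rewrite /record_pos size_rcons -addn1 iotaD find_cat.
rewrite ifF; last first.
  apply/negbTE/hasPn => i; rewrite mem_iota add0n nth_rcons => /= lti.
  rewrite lti negb_and; apply/orP; right.
  by rewrite neq_ltn (leq_ltn_trans (leq_max_letter (mem_nth 0 lti))).
rewrite size_iota /= /is_record !nth_rcons ltnn !eqxx -cats1 takel_cat // take_size.
rewrite andbT (_ : all _ _) ?addn0 //.
by apply/allP => y /leq_max_letter; lia.
Qed.

Definition sum_before_records w :=
  \sum_(1 <= a < (max_letter w).+1) sumelements_at w a.

Lemma sumelements_at_rcons w c a : restricted_growth w -> 0 < a <= max_letter w ->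
  sumelements_at (rcons w c) a = sumelements_at w a.
Proof.
move=> rgw ha; rewrite /sumelements_at record_pos_rcons // -cats1 takel_cat //.
exact/ltnW/record_pos_lt.
Qed.

Lemma sum_before_records_old w c : restricted_growth w -> c <= max_letter w ->
  sum_before_records (rcons w c) = sum_before_records w.
Proof.
move=> rgw lec; rewrite /sum_before_records max_letter_rcons (maxn_idPl lec).
by apply: eq_big_nat => a ha; rewrite sumelements_at_rcons.
Qed.

Lemma sum_before_records_new w : restricted_growth w ->
  sum_before_records (rcons w (max_letter w).+1) = sum_before_records w + sumn w.
Proof.
move=> rgw; rewrite /sum_before_records max_letter_rcons (maxn_idPr (leqnSn _)).
rewrite big_nat_recr //=; congr (_ + _).
  by apply: eq_big_nat => a ha; rewrite sumelements_at_rcons.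
by rewrite /sumelements_at record_pos_new // -cats1 takel_cat // take_size.
Qed.

End Words.

(** * Sums over words, split by the last letter *)

Section WordSums.
Implicit Types (F : seq nat -> rat).

Definition word_sum n k F : rat :=
  \sum_(w <- rg_words n | max_letter w == k) F w.

Lemma word_sumS n k F :
  word_sum n.+1 k F =
    word_sum n k (fun w => \sum_(1 <= c < k.+1) F (rcons w c)) +
    (if k is k'.+1 then word_sum n k' (fun w => F (rcons w k)) else 0).
Proof.
rewrite /word_sum big_mkcond big_allpairs_dep.
(* Only the last admissible letter changes the maximum; it is split off from the letters that keep
   it. *)
have step w : \sum_(c <- iota 1 (max_letter w).+1)
      (if max_letter (rcons w c) == k then F (rcons w c) else 0) =
    (if max_letter w == k then \sum_(1 <= c < k.+1) F (rcons w c) else 0) +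
    (if (max_letter w).+1 == k then F (rcons w k) else 0).
  rewrite -[X in iota 1 X]addn1 iotaD big_cat /= big_seq1 add1n.
  congr (_ + _); last first.
    by rewrite max_letter_rcons (maxn_idPr (leqnSn _)); case: eqP => // ->.
  case: eqP => [<-|nek].
    rewrite /index_iota subn1 /= [LHS]big_seq [RHS]big_seq; apply: eq_bigr => c.
    by rewrite mem_iota max_letter_rcons => hc; rewrite (maxn_idPl _) ?eqxx //; lia.
  rewrite big_seq big1 // => c; rewrite mem_iota max_letter_rcons => hc.
  by rewrite (maxn_idPl _); [case: eqP | lia].
under eq_bigr do rewrite step.
rewrite big_split -big_mkcond; congr (_ + _).
by case: k {step} => [|k]; [rewrite big1 | rewrite -big_mkcond].
Qed.

End WordSums.

(** * Canonical forms of set partitions are the restricted growth words *)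

Section CanonicalForm.
Local Open Scope nat_scope.
Variable n : nat.
Implicit Types (B : {set 'I_n}) (P : {set {set 'I_n}}).

Lemma min_block_le B (i : 'I_n) : i \in B -> min_block B <= i.
Proof.
move=> iB; rewrite /min_block; have := mem_index_enum i.
elim: (index_enum _) => [//|j s IHs]; rewrite inE big_cons => /predU1P[<-|/IHs lei].
  by rewrite iB geq_minl.
by case: ifP => _ //; apply: leq_trans (geq_minr _ _) lei.
Qed.

Lemma min_block_mem B : B != set0 -> exists2 i : 'I_n, i \in B & min_block B = i.
Proof.
case/set0Pn => i iB.
(* The left case is the default value [n]; it is excluded since the minimum is at most [i], and [i]
   is below [n]. *)
have : min_block B = n \/ exists2 j : 'I_n, j \in B & min_block B = j.
  rewrite /min_block; elim/big_rec: _ => [|j m jB IHm]; first by left.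
  right; rewrite /minn; case: ltnP => lejm; first by exists j.
  case: IHm => [eqmn | //].
  by move: lejm; rewrite eqmn leqNgt ltn_ord.
case=> // eqn; have := min_block_le iB; rewrite eqn leqNgt.
by rewrite ltn_ord.
Qed.

Lemma mem_blocks P : blocks P =i P.
Proof. by move=> B; rewrite mem_sort mem_enum. Qed.

Lemma blocks_uniq P : uniq (blocks P).
Proof. by rewrite sort_uniq enum_uniq. Qed.

Lemma size_blocks P : size (blocks P) = #|P|.
Proof. by rewrite size_sort -cardE. Qed.

Lemma size_canonical_form P : size (canonical_form P) = n.
Proof. by rewrite size_map size_enum_ord. Qed.

Section Partition.
Variable P : {set {set 'I_n}}.
Hypothesis partP : partition P [set: 'I_n].

Definition block_index (i : 'I_n) := find (fun B => i \in B) (blocks P).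

Lemma nth_canonical_form (i : 'I_n) : nth 0 (canonical_form P) i = (block_index i).+1.
Proof. by rewrite (nth_map i) ?nth_ord_enum // size_enum_ord. Qed.

Lemma has_block (i : 'I_n) : has (fun B => i \in B) (blocks P).
Proof.
case/and3P: partP => /eqP cov _ _; have : i \in cover P by rewrite cov inE.
by case/bigcupP => B BP iB; apply/hasP; exists B; rewrite ?mem_blocks.
Qed.

Lemma block_index_lt (i : 'I_n) : block_index i < #|P|.
Proof. by rewrite -size_blocks -has_find has_block. Qed.

Lemma mem_block_index (i : 'I_n) : i \in nth set0 (blocks P) (block_index i).
Proof. exact: (nth_find set0 (has_block i)). Qed.

Lemma nth_blocks b : b < #|P| -> nth set0 (blocks P) b \in P.
Proof. by move=> ltb; rewrite -mem_blocks mem_nth ?size_blocks. Qed.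

Lemma pblock_nth_blocks b (i : 'I_n) : b < #|P| ->
  i \in nth set0 (blocks P) b -> pblock P i = nth set0 (blocks P) b.
Proof.
by case/and3P: partP => _ triv _ ltb ib; apply: def_pblock; rewrite ?nth_blocks.
Qed.

Lemma block_index_uniq b (i : 'I_n) : b < #|P| ->
  i \in nth set0 (blocks P) b -> block_index i = b.
Proof.
move=> ltb ib; apply/eqP.
rewrite -(nth_uniq set0 _ _ (blocks_uniq P)) ?size_blocks ?block_index_lt //.
rewrite -(pblock_nth_blocks ltb ib).
by rewrite -(pblock_nth_blocks (block_index_lt i) (mem_block_index i)).
Qed.

Lemma canonical_form_kernel (i j : 'I_n) :
  (nth 0 (canonical_form P) i == nth 0 (canonical_form P) j) = (j \in pblock P i).
Proof.
rewrite !nth_canonical_form eqSS.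
rewrite (pblock_nth_blocks (block_index_lt i) (mem_block_index i)).
apply/eqP/idP => [-> | jb]; first exact: mem_block_index.
by rewrite (block_index_uniq (block_index_lt i) jb).
Qed.

Lemma nth_blocks_mem b : b < #|P| -> exists2 i : 'I_n,
  i \in nth set0 (blocks P) b & min_block (nth set0 (blocks P) b) = i.
Proof.
case/and3P: partP => _ _ /memPn ne0 ltb.
by apply: min_block_mem; apply: ne0; apply: nth_blocks.
Qed.

(** Blocks are sorted by their minima, so the minimum [j] of the block preceding that of [i] lies
    before [i]. The prefix thus already contains the letter one below that of [i]. *)
Lemma canonical_form_restricted_growth : restricted_growth (canonical_form P).
Proof.
move=> i; rewrite size_canonical_form => lti.
rewrite -[i]/(nat_of_ord (Ordinal lti)); move: (Ordinal lti) => {lti}i.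
rewrite nth_canonical_form /= ltnS.
have := block_index_lt i; have := mem_block_index i.
have := @block_index_uniq ^~ i.
case: (block_index i) => [//|b] uniqb ib ltb.
have ltb' := ltnW ltb; have [j jb minj] := nth_blocks_mem ltb'.
have leji : j <= i.
  rewrite -minj; apply: leq_trans (min_block_le ib).
  have sortb : sorted (fun B C => min_block B <= min_block C) (blocks P).
    by apply: sort_sorted => B C; apply: leq_total.
  have tr : transitive (fun B C => min_block B <= min_block C).
    by move=> A B C; apply: leq_trans.
  by apply: (sorted_ltn_nth tr set0 sortb); rewrite ?inE ?size_blocks.
have ltji : j < i.
  rewrite ltn_neqAle leji andbT; apply/eqP => /val_inj eqji; subst j.
  by have /eqP := uniqb _ ltb' jb; rewrite gtn_eqF.
apply: leq_max_letter; apply/(nthP 0); exists (j : nat).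
  by rewrite size_take size_canonical_form; case: ifP.
by rewrite nth_take // nth_canonical_form (block_index_uniq ltb' jb).
Qed.

Lemma max_letter_canonical_form : max_letter (canonical_form P) = #|P|.
Proof.
apply/eqP; rewrite eqn_leq; apply/andP; split.
  apply/bigmax_leqP_seq => c /mapP[i _ ->] _; exact: block_index_lt.
case eqk : #|P| => [//|k].
have ltk : k < #|P| by rewrite eqk.
have [j jb _] := nth_blocks_mem ltk.
rewrite -(block_index_uniq ltk jb) -nth_canonical_form.
by apply/leq_max_letter/mem_nth; rewrite size_canonical_form.
Qed.

End Partition.

(** A partition is recovered from its relation of lying in one block, which is the kernel of its
    word. *)
Lemma canonical_form_inj P Q :
  partition P [set: 'I_n] -> partition Q [set: 'I_n] ->
  canonical_form P = canonical_form Q -> P = Q.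
Proof.
move=> partP partQ eqPQ.
rewrite -(equivalence_partition_pblock partP) -(equivalence_partition_pblock partQ).
by congr equivalence_partition; apply/funext => i; apply/funext => j;
  rewrite -!canonical_form_kernel // eqPQ.
Qed.

(** The witness is the partition of the positions by their letters. Its canonical form has the same
    kernel as [w], and a restricted growth word is determined by its kernel. *)
Lemma canonical_form_surj w : size w = n -> restricted_growth w ->
  exists2 P, partition P [set: 'I_n] & canonical_form P = w.
Proof.
move=> szw rgw; pose f (i : 'I_n) := nth 0 w i.
have partf := preim_partitionP f [set: 'I_n].
exists (preim_partition f [set: 'I_n]) => //.
apply: restricted_growth_kernel_inj => //; rewrite ?size_canonical_form //.
  exact: canonical_form_restricted_growth.
move=> i j lti ltj.
have /= -> := canonical_form_kernel partf (Ordinal lti) (Ordinal ltj).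
rewrite pblock_equivalence_partition ?inE //.
by split=> // /eqP ->.
Qed.

(** Reindexing along the bijection given by [canonical_form]; the number of blocks becomes the
    maximal letter. *)
Lemma sum_set_partitions k (F : seq nat -> rat) :
  (\sum_(P in set_partitions n k) F (canonical_form P) = word_sum n k F)%R.
Proof.
rewrite /word_sum -[RHS]big_filter -big_enum -(big_map (@canonical_form n) predT) /=.
apply/perm_big/uniq_perm; rewrite ?filter_uniq ?rg_words_uniq //.
  rewrite map_inj_in_uniq ?enum_uniq // => P Q.
  by rewrite !mem_enum !inE => /andP[partP _] /andP[partQ _]; apply: canonical_form_inj.
move=> w; rewrite mem_filter; apply/mapP/andP => [[P] | [/eqP maxw]].
  rewrite mem_enum inE => /andP[partP /eqP <-] ->.
  rewrite max_letter_canonical_form // eqxx; split=> //; apply/mem_rg_words.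
  by split; [apply: size_canonical_form | apply: canonical_form_restricted_growth].
case/mem_rg_words => szw /(canonical_form_surj szw) [P partP cfP].
exists P; rewrite ?mem_enum ?inE ?partP -?cfP //.
by rewrite -max_letter_canonical_form // cfP maxw /=.
Qed.

End CanonicalForm.

Lemma sumelementsE n (P : {set {set 'I_n}}) : partition P [set: 'I_n] ->
  sumelements P = sum_before_records (canonical_form P).
Proof. by move=> partP; rewrite /sum_before_records max_letter_canonical_form. Qed.

(** * Exponential generating functions and their recurrences *)

(** Multiplication by u, when [G k] is read as the coefficient of u^k. *)
Definition shift_seq (G : nat -> fps rat) k := if k is k'.+1 then G k' else 0.

(** By induction on [k] the shifted term is the same on both sides, which leaves one linear equation
    with a given constant term. *)
Lemma shift_ode_uniq (G H S : nat -> fps rat) :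
    (forall k, G k 0%N = H k 0%N) ->
    (forall k, fps_deriv (G k) = k%:R *: G k + shift_seq G k + S k) ->
    (forall k, fps_deriv (H k) = k%:R *: H k + shift_seq H k + S k) ->
  forall k, G k = H k.
Proof.
move=> eq0 DG DH k; elim: k => [|k IHk]; apply: fps_ode_uniq (eq0 _) _.
  by rewrite DG DH /=; ring.
by rewrite DG DH /= IHk; ring.
Qed.

Definition word_egf (F : seq nat -> rat) k : fps rat :=
  FPS (fun n => word_sum n k F / n`!%:R).

Lemma word_egf0 F k : word_egf F k 0%N = if k == 0%N then F [::] else 0.
Proof.
rewrite /= /word_sum /= big_cons big_nil /max_letter big_nil eq_sym divr1.
by case: eqP => //; rewrite addr0.
Qed.

(** Differentiation turns words of length n into words of length n + 1, whose last letter is then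
    removed by [word_sumS]. *)
Lemma word_egf_deriv F k :
  fps_deriv (word_egf F k) =
    word_egf (fun w => \sum_(1 <= c < k.+1) F (rcons w c)) k +
    shift_seq (fun k' => word_egf (fun w => F (rcons w k'.+1)) k') k.
Proof.
apply: fpsP => n.
have -> : fps_deriv (word_egf F k) n = word_sum n.+1 k F / n`!%:R.
  rewrite /= factS natrM; field.
  by rewrite pnatr_eq0 -lt0n fact_gt0 nat1r pnatr_eq0.
by rewrite word_sumS mulrDl; case: k => [|k] /=; rewrite ?mul0r.
Qed.

Lemma eq_word_egf k (F G : seq nat -> rat) :
    (forall w, restricted_growth w -> max_letter w = k -> F w = G w) ->
  word_egf F k = word_egf G k.
Proof.
move=> eqFG; apply: fpsP => n /=; congr (_ / _).
rewrite /word_sum big_seq_cond [RHS]big_seq_cond; apply: eq_bigr => w.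
by case/andP => /mem_rg_words[_ rgw] /eqP; apply: eqFG.
Qed.

Lemma word_egfD F G k :
  word_egf (fun w => F w + G w) k = word_egf F k + word_egf G k.
Proof. by apply: fpsP => n /=; rewrite /word_sum big_split mulrDl. Qed.

Lemma word_egfZ a F k : word_egf (fun w => a * F w) k = a *: word_egf F k.
Proof. by apply: fpsP => n /=; rewrite /word_sum -mulr_sumr mulrA. Qed.

Lemma sum_natr_nat k : \sum_(1 <= c < k.+1) c%:R = k%:R * (k%:R + 1) / 2 :> rat.
Proof.
elim: k => [|k IHk]; first by rewrite big_geq // !mul0r.
by rewrite big_nat_recr //= IHk; field.
Qed.

Definition egf_count := word_egf (fun=> 1).
Definition egf_sum := word_egf (fun w => (sumn w)%:R).
Definition egf_sum_before_records := word_egf (fun w => (sum_before_records w)%:R).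

(** The source [0] is written out to fit the form of [shift_ode_uniq]. *)
Lemma egf_count_deriv k :
  fps_deriv (egf_count k) = k%:R *: egf_count k + shift_seq egf_count k + 0.
Proof.
rewrite addr0 [LHS]word_egf_deriv; congr (_ + _).
rewrite -word_egfZ; apply: eq_word_egf => w _ _.
by rewrite sumr_const_nat subn1 mulr1.
Qed.

Lemma egf_sum_deriv k :
  fps_deriv (egf_sum k) = k%:R *: egf_sum k + shift_seq egf_sum k +
    ((k%:R * (k%:R + 1) / 2) *: egf_count k + k%:R *: shift_seq egf_count k).
Proof.
rewrite [LHS]word_egf_deriv addrACA; congr (_ + _).
  rewrite -!word_egfZ -word_egfD; apply: eq_word_egf => w _ _.
  (* The k extensions without a record each repeat the old sum, and their new letters add 1 + ... +
     k. *)
  under eq_bigr do rewrite sumn_rcons natrD.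
  rewrite big_split /= sumr_const_nat subn1 sum_natr_nat mulr1.
  by congr (_ + _); rewrite mulr_natl.
case: k => [|k] /=; first by rewrite scale0r addr0.
rewrite -word_egfZ -word_egfD; apply: eq_word_egf => w _ _.
by rewrite sumn_rcons natrD mulr1.
Qed.

Lemma egf_sum_before_records_deriv k :
  fps_deriv (egf_sum_before_records k) =
    k%:R *: egf_sum_before_records k + shift_seq egf_sum_before_records k +
    shift_seq egf_sum k.
Proof.
rewrite [LHS]word_egf_deriv -addrA; congr (_ + _).
  rewrite -word_egfZ; apply: eq_word_egf => w rgw maxw.
  rewrite (eq_big_nat _ _ (F2 := fun=> (sum_before_records w)%:R)) => [|c hc].
    by rewrite sumr_const_nat subn1 mulr_natl.
  by rewrite sum_before_records_old //; lia.
case: k => [|k] /=; first by rewrite addr0.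
rewrite -word_egfD; apply: eq_word_egf => w rgw maxw.
by rewrite -maxw sum_before_records_new // natrD.
Qed.

(* (e^x - 1)^(k - j) / (k - j)! when [g] is e^x - 1: the series of the partitions
   into [k - j] blocks. *)
Definition shifted_block_egf (g : fps rat) j k : fps rat :=
  if (j <= k)%N then (k - j)`!%:R^-1 *: g ^+ (k - j) else 0.

(** * Shifted powers of a series g with g' = g + 1 *)

Section Shifted.
Variable g : fps rat.

Lemma shift_shifted_block j k :
  shift_seq (shifted_block_egf g j) k = shifted_block_egf g j.+1 k.
Proof. by case: k. Qed.

(** With m = k - j > 0, the derivative of g^m/m! is g^(m-1)/(m-1)! times g + 1, and g^m/(m-1)! is m
    g^m/m!. For k < j the series vanish, so the negative factor is harmless. *)
Lemma shifted_block_deriv j k : fps_deriv g = g + 1 ->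
  fps_deriv (shifted_block_egf g j k) =
    (k%:R - j%:R) * shifted_block_egf g j k + shifted_block_egf g j.+1 k.
Proof.
move=> Dg; rewrite /shifted_block_egf.
have [lejk|ltkj] := leqP j k; last first.
  rewrite ltnNge (ltnW ltkj) /= mulr0 addr0.
  by have := fps_deriv_alg (0 : rat); rewrite scale0r.
rewrite -natrB // subnS.
have -> : (j < k)%N = (0 < k - j)%N by rewrite subn_gt0.
case: (k - j)%N => [|m] /=.
  by rewrite expr0 mul0r addr0 fps_deriv_alg.
rewrite fps_derivZ fps_derivXn Dg mulrDr mulr1 -exprSr !scalerDr -mulr_natl.
rewrite !scalerA -!scalerAr !mulr_natl -!scaler_nat !scalerA.
congr (_ *: _ + _ *: _).
by rewrite factS natrM invfM mulrC mulrA divff ?mul1r // pnatr_eq0.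
Qed.

(** This trades a factor depending on [k] for multiplication by [g], which makes weights independent
    of [k] possible. *)
Lemma mul_shifted_block j k :
  g * shifted_block_egf g j.+1 k = (k%:R - j%:R) * shifted_block_egf g j k.
Proof.
rewrite /shifted_block_egf; have [lejk|ltkj] := leqP j k; last first.
  by rewrite ltnNge (ltnW ltkj) /= !mulr0.
rewrite -natrB // subnS.
have -> : (j < k)%N = (0 < k - j)%N by rewrite subn_gt0.
case: (k - j)%N => [|m] /=; first by rewrite mulr0 mul0r.
rewrite -scalerAr -exprS mulr_natl -scaler_nat scalerA; congr (_ *: _).
by rewrite factS natrM invfM mulrA divff ?mul1r // pnatr_eq0.
Qed.

Lemma shifted_block0 j k : g 0%N = 0 ->
  shifted_block_egf g j k 0%N = (j == k)%:R.
Proof.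
move=> g0; rewrite /shifted_block_egf; case: ltngtP => [ltjk|//|->] /=.
  by rewrite fps_expr_order ?mulr0 // subn_gt0.
by rewrite subnn expr0 /= divr1.
Qed.

(** Whatever [j] is, summing g^(k-j)/(k-j)! over k gives e^g; up to degree n only j <= k <= j + n
    contribute. *)
Lemma sum_shifted_block j K (f : fps rat) n : g 0%N = 0 -> (j + n < K)%N ->
  \sum_(k < K) (shifted_block_egf g j k * f) n = (fps_exp g * f) n.
Proof.
move=> g0 ltK; rewrite -fps_sum_coef -mulr_suml !fps_mul_coef.
apply: eq_bigr => i _; congr (_ * _); rewrite fps_sum_coef.
have {ltK} : (j + i < K)%N by case: i => /= i; lia.
move: (nat_of_ord i) => {}i ltK.
rewrite -(big_mkord predT (fun k => shifted_block_egf g j k i)).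
(* Terms with k < j vanish by definition and those with k - j > i by the order of g^(k-j); the rest
   is the finite sum defining [fps_exp]. *)
rewrite (big_cat_nat (n := j)) //=; last lia.
rewrite big_nat big1 ?add0r => [|k /andP[_ ltkj]]; last first.
  by rewrite /shifted_block_egf leqNgt ltkj.
rewrite -{1}[j]add0n big_addn (big_cat_nat (n := i.+1)) //=; last lia.
rewrite [X in _ + X]big_nat [X in _ + X]big1 ?addr0 => [|k /andP[ltik _]]; last first.
  by rewrite /shifted_block_egf leq_addl addnK /= fps_expr_order // mulr0.
rewrite big_mkord; apply: eq_bigr => k _.
by rewrite /shifted_block_egf leq_addl addnK.
Qed.

End Shifted.

(** * Closed forms of the solutions *)

Lemma fps_scale_nat m (f : fps rat) : m%:R *: f = m%:R * f.
Proof. by rewrite scaler_nat mulr_natl. Qed.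

(** A common denominator as a constant series: rational coefficients become integer multiples of it,
    so that [ring] applies, modulo [twelfthE]. *)
Definition twelfth : fps rat := (1 / 12)%:A.

Lemma twelfthE : 12%:R * twelfth = 1.
Proof. by rewrite mulr_natl -scaler_nat scalerA mul1r divff ?scale1r. Qed.

(* [v], [v2] and [v3] stand for e^x, e^(2x) and e^(3x); as variables they keep
   unification from unfolding [fps_exp]. *)
Section Solution.

Local Notation x := (fpsX : fps rat).
Variables v v2 v3 : fps rat.
Hypotheses (v_0 : v 0%N = 1) (v2_0 : v2 0%N = 1) (v3_0 : v3 0%N = 1).
Hypothesis v_deriv : fps_deriv v = v.
Hypothesis v2_deriv : fps_deriv v2 = 2 *: v2.
Hypothesis v3_deriv : fps_deriv v3 = 3 *: v3.

Local Notation B := (shifted_block_egf (v - 1)).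

Let v2_deriv' : fps_deriv v2 = 2%:R * v2.
Proof. by rewrite v2_deriv fps_scale_nat. Qed.

Let v3_deriv' : fps_deriv v3 = 3%:R * v3.
Proof. by rewrite v3_deriv fps_scale_nat. Qed.

(* With B_j the series of the partitions into k - j blocks, the generating
   functions of the two statistics are looked for in the form
   B_1 s1 + B_2 s2 and B_2 t2 + B_3 t3; the recurrences then become
   s1' = s1 + v, s2' = 2 s2 + (v^2 - 1) / 2, t2' = 2 t2 + s1, t3' = 3 t3 + s2,
   which these solve with value 0 at x = 0. *)
Definition sum_weight1 := x * v.
Definition sum_weight2 := twelfth * (6%:R * x * v2 + 3%:R - 3%:R * v2).
Definition record_weight2 := v2 - x * v - v.
Definition record_weight3 :=
  twelfth * (4%:R * v3 - 6%:R * x * v2 - 3%:R * v2 - 1).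

Local Notation s1 := sum_weight1.
Local Notation s2 := sum_weight2.
Local Notation t2 := record_weight2.
Local Notation t3 := record_weight3.

Lemma exp2E : v2 = v * v.
Proof.
have e : 1 + 1 = 2 :> rat by [].
have Dv : fps_deriv v = 1 *: v by rewrite scale1r v_deriv.
by rewrite (fps_eigen_mul Dv Dv v2_deriv e) // v_0 v2_0 mulr1.
Qed.

Lemma sum_weight1_deriv : fps_deriv s1 = s1 + v.
Proof. by rewrite !fps_derivE v_deriv mul1r addrC. Qed.

Lemma sum_weight2_deriv : fps_deriv s2 = 2%:R * s2 + 6%:R * twelfth * (v2 - 1).
Proof. by rewrite /s2 !fps_derivE v2_deriv'; ring. Qed.

Lemma record_weight2_deriv : fps_deriv t2 = 2%:R * t2 + s1.
Proof. by rewrite /t2 !fps_derivE v2_deriv' v_deriv /s1; ring. Qed.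

Lemma record_weight3_deriv : fps_deriv t3 = 3%:R * t3 + s2.
Proof. by rewrite /t3 !fps_derivE v2_deriv' v3_deriv' /s2; ring. Qed.

Lemma expm1_deriv : fps_deriv (v - 1) = (v - 1) + 1.
Proof. by rewrite !fps_derivE v_deriv subr0 subrK. Qed.

Lemma expm1_0 : (v - 1) 0%N = 0.
Proof. by rewrite -[LHS]/(v 0%N - 1) v_0 subrr. Qed.

Lemma block_deriv j k : fps_deriv (B j k) = (k%:R - j%:R) * B j k + B j.+1 k.
Proof. exact: shifted_block_deriv expm1_deriv. Qed.

Lemma mul_block j k : (v - 1) * B j.+1 k = (k%:R - j%:R) * B j k.
Proof. exact: mul_shifted_block. Qed.

Lemma shift_block j k : shift_seq (B j) k = B j.+1 k.
Proof. exact: shift_shifted_block. Qed.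

Lemma shift_combination i j (f g : fps rat) k :
  shift_seq (fun k => B i k * f + B j k * g) k = B i.+1 k * f + B j.+1 k * g.
Proof. by rewrite -!shift_block; case: k => //=; rewrite !mul0r addr0. Qed.

Lemma egf_countE k : egf_count k = B 0 k.
Proof.
apply: (@shift_ode_uniq _ (B 0) (fun=> 0)) k => k.
- by rewrite word_egf0 [RHS]shifted_block0 ?expm1_0 //; case: k.
- by rewrite egf_count_deriv.
by rewrite block_deriv shift_block fps_scale_nat subr0 addr0.
Qed.

Lemma weights_0 : (s1 0%N = 0) * (s2 0%N = 0) * (t2 0%N = 0) * (t3 0%N = 0).
Proof.
have x_0 : x 0%N = 0 by [].
(* At 0 every term with x vanishes and the constants cancel: 3 - 3, 1 - 1 and 4 - 3 - 1. *)
rewrite /s1 /s2 /t2 /t3; move: x twelfth x_0 => y c y_0.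
by do !split; rewrite ?(fps_coefD, fps_coefN, fps_mul_coef0) ?y_0 ?v_0 ?v2_0
  ?v3_0 ?fps_coef_nat; ring.
Qed.

(* From (v - 1) B_1 = k B_0 and (v - 1) B_2 = (k - 1) B_1. *)
Lemma sum_source k :
  (k%:R * (k%:R + 1) / 2) *: B 0 k + k%:R *: B 1 k =
  B 1 k * v + 6%:R * twelfth * (v2 - 1) * B 2 k.
Proof.
have -> : (k%:R * (k%:R + 1) / 2) *: B 0 k =
    6%:R * twelfth * (k%:R * (k%:R + 1)) * B 0 k.
  have -> : k%:R * (k%:R + 1) / 2 = (6 * (k * k.+1))%:R * (1 / 12) :> rat.
    by rewrite !natrM; field.
  by rewrite -scalerA fps_scale_nat -mulr_algl -/twelfth !natrM; ring.
rewrite fps_scale_nat exp2E.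
have M1 : (v - 1) * B 1 k - k%:R * B 0 k = 0 by rewrite mul_block subr0 subrr.
have M2 : (v - 1) * B 2 k - (k%:R - 1) * B 1 k = 0 by rewrite mul_block subrr.
have C : 12%:R * twelfth - 1 = 0 by rewrite twelfthE subrr.
move: (B 0 k) (B 1 k) (B 2 k) twelfth M1 M2 C => b0 b1 b2 c M1 M2 C.
apply/esym/eqP; rewrite -subr_eq0; apply/eqP.
(* The cofactors record a reduction of the difference: (v - 1) b2 is replaced by [M2], then (v - 1)
   b1 by [M1], and finally 12 c by 1. *)
transitivity ((1 + 6%:R * c * (k%:R - 1)) * ((v - 1) * b1 - k%:R * b0) +
  6%:R * c * (v + 1) * ((v - 1) * b2 - (k%:R - 1) * b1) +
  (12%:R * c - 1) * ((k%:R - 1) * b1 - k%:R * b0)); first ring.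
by rewrite M1 M2 C !(mulr0, mul0r) !addr0.
Qed.

(** In the derivative of B_j s_j, the -j from B_j' cancels the term j s_j of s_j'. What remains is k
    B_j s_j, the shift B_(j+1) s_j and the source. *)
Lemma egf_sumE k : egf_sum k = B 1 k * s1 + B 2 k * s2.
Proof.
apply: (@shift_ode_uniq _ (fun k => B 1 k * s1 + B 2 k * s2)
          (fun k => (k%:R * (k%:R + 1) / 2) *: B 0 k + k%:R *: B 1 k)) k => k.
- rewrite word_egf0 if_same fps_coefD.
  by rewrite fps_mul_coef0 [X in _ + X]fps_mul_coef0 !weights_0 !mulr0 addr0.
- rewrite egf_sum_deriv egf_countE; congr (_ + (_ + _ *: _)).
  by rewrite -shift_block; case: k => //= k; apply: egf_countE.
rewrite sum_source shift_combination fps_derivD (fps_derivM _ s1).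
rewrite (fps_derivM _ s2) !block_deriv.
by rewrite sum_weight1_deriv sum_weight2_deriv fps_scale_nat; ring.
Qed.

(** The same cancellation, with the shift of [egf_sumE] as source. *)
Lemma egf_sum_before_recordsE k :
  egf_sum_before_records k = B 2 k * t2 + B 3 k * t3.
Proof.
apply: (@shift_ode_uniq _ (fun k => B 2 k * t2 + B 3 k * t3)
          (fun k => B 2 k * s1 + B 3 k * s2)) k => k.
- rewrite word_egf0 /sum_before_records /max_letter big_nil big_geq // if_same fps_coefD.
  by rewrite fps_mul_coef0 [X in _ + X]fps_mul_coef0 !weights_0 !mulr0 addr0.
- rewrite egf_sum_before_records_deriv -shift_combination; congr (_ + _).
  by case: k => //= k; apply: egf_sumE.
rewrite shift_combination fps_derivD (fps_derivM _ t2) (fps_derivM _ t3) !block_deriv.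
by rewrite record_weight2_deriv record_weight3_deriv fps_scale_nat; ring.
Qed.

(** The bound comes from B_3, which contributes to degrees up to n only for k <= n + 3. *)
Lemma sum_egf_sum_before_records n K : (n + 3 < K)%N ->
  \sum_(k < K) egf_sum_before_records k n = (fps_exp (v - 1) * (t2 + t3)) n.
Proof.
move=> ltK; under eq_bigr do rewrite egf_sum_before_recordsE fps_coefD.
rewrite big_split !sum_shifted_block ?expm1_0 //; try lia.
by rewrite (mulrDr _ t2 t3).
Qed.

End Solution.

(** * Evaluation of the derivative at q = u = 1 *)

Lemma Ptilde_deriv_coef n k :
  eval_q 1 (deriv_q Ptilde) n k = egf_sum_before_records k n.
Proof.
rewrite /= linear_sum horner_sum /= -sum_set_partitions mulr_suml.
apply: eq_bigr => P; rewrite inE => /andP[partP _].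
rewrite linearZ /= derivXn hornerZ hornerMn hornerXn expr1n mulrC.
by rewrite sumelementsE.
Qed.

Theorem theorem3 :
  eval_u (eval_q 1 (deriv_q Ptilde)) 1
    (fps_exp (fps_exp fpsX - 1) *
     ((1 / 3) *: fps_exp (3 *: fpsX)
      - (1 / 2) *: (fpsX * fps_exp (2 *: fpsX))
      + (3 / 4) *: fps_exp (2 *: fpsX)
      - fpsX * fps_exp fpsX
      - fps_exp fpsX
      - (1 / 12)%:A)).
Proof.
move=> n; exists (n + 4)%N => K leK.
under eq_bigr do rewrite expr1n mulr1 Ptilde_deriv_coef.
have D1 : fps_deriv (fps_exp (fpsX : fps rat)) = fps_exp fpsX.
  by have := fps_deriv_exp 1; rewrite !scale1r.
rewrite (sum_egf_sum_before_records (fps_exp0 _) (fps_exp0 _) (fps_exp0 _)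
  D1 (fps_deriv_exp 2) (fps_deriv_exp 3)); last lia.
move: (fps_exp (2 *: _)) (fps_exp (3 *: _)) (fps_exp fpsX) => v2 v3 v.
congr (fps_coef (_ * _) n).
rewrite /record_weight2 /record_weight3.
have scaleE m (f : fps rat) : (m%:R / 12) *: f = m%:R * twelfth * f.
  by rewrite -scalerA fps_scale_nat -mulr_algl -mulrA /twelfth div1r.
have -> : 1 / 3 = 4%:R / 12 :> rat by field.
have -> : 1 / 2 = 6%:R / 12 :> rat by field.
have -> : 3 / 4 = 9%:R / 12 :> rat by field.
rewrite -/twelfth !scaleE.
have C : 12%:R * twelfth - 1 = 0 by rewrite twelfthE subrr.
apply/eqP; rewrite -subr_eq0; apply/eqP.
(* Only e^(2x) has coefficients that differ formally: 1 - 3/12 from the weights against 9/12. *)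
transitivity (- (12%:R * twelfth - 1) * v2); first ring.
by rewrite C oppr0 mul0r.
Qed.
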